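(* For every infinite cardinal $\kappa$ there is a continuous function $F\colon\mathrm{Mod}^\kappa_{\mathrm{DLO}}\to\mathrm{Mod}^\kappa_G$ which preserves both embeddability and isomorphism, i.e. for all $\eta,\xi\in\mathrm{Mod}^\kappa_{\mathrm{DLO}}$: $\mathcal{A}_\eta$ embeds into $\mathcal{A}_\xi$ iff $\mathcal{A}_{F(\eta)}$ embeds into $\mathcal{A}_{F(\xi)}$, and $\mathcal{A}_\eta\cong\mathcal{A}_\xi$ iff $\mathcal{A}_{F(\eta)}\cong\mathcal{A}_{F(\xi)}$.
   Context: $\kappa^\kappa$ carries the bounded topology (basic open sets $\{\eta\mid p\subset\eta\}$, $p\in\kappa^{<\kappa}$) and $2^\kappa$, $\mathrm{Mod}^\kappa_{\mathrm{DLO}}$, $\mathrm{Mod}^\kappa_G$ carry subspace topologies. Coding: fix a bijection $\pi\colon\kappa^{<\omega}\to\kappa$; for $\eta\in2^\kappa$ and a countable relational vocabulary $\{P_n\}$, $\mathcal{A}_\eta$ has domain $\kappa$ with $(a_1,\dots,a_n)\in P_m^{\mathcal{A}_\eta}$ iff $\eta(\pi(m,a_1,\dots,a_n))=1$. $\mathrm{Mod}^\kappa_{\mathrm{DLO}}$ is the set of $\eta$ with $\mathcal{A}_\eta$ a dense linear order without endpoints; $\mathrm{Mod}^\kappa_G$ is the set of $\eta$ with $\mathcal{A}_\eta$ a graph (symmetric irreflexive binary relation). *)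

(* Defs.v *)
From HB Require Import structures.
From mathcomp Require Import all_boot all_order finmap.
From mathcomp Require Import all_classical wochoice topology.

Set Implicit Arguments.
Unset Strict Implicit.
Unset Printing Implicit Defensive.

Import Order.TTheory.

Local Open Scope classical_set_scope.
Local Open Scope card_scope.
Local Open Scope order_scope.

(* An infinite cardinal, in the von Neumann sense: an infinite initial ordinal,
   i.e. a well-ordered type (its elements are the ordinals below it) of larger
   cardinality than each of its proper initial segments. *)
Record infinite_cardinal := InfiniteCardinal {
  card_disp : Order.disp_t;
  card_sort :> orderType card_disp;
  card_wo : well_order (<=%O : rel card_sort);
  card_initial : forall a : card_sort, ~ ([set: card_sort] #<= [set b | b < a]);
  card_infinite : infinite_set [set: card_sort] }.

Lemma finite_ordinal_exists (kappa : infinite_cardinal) (n : nat) :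
  exists a : kappa, [set b | b < a] #= `I_n.
Proof.
elim: n => [|n [a an]].
  have [a _] := infinite_setN0 (@card_infinite kappa).
  have [z [[_ zmin] _]] := @card_wo kappa predT (ex_intro _ a isT).
  exists z; rewrite II0 card_eq0; apply/eqP; rewrite -subset0 => b /=.
  by rewrite ltNge zmin.
have [c ac] : exists c, a < c.
  apply: contrapT => /forallNP nac.
  apply: (@card_infinite kappa); apply: (@sub_finite_set _ _ (a |` [set b | b < a])).
    move=> b _ /=; have [ba|ab|->] := ltgtP b a; [by right| |by left].
    by case: (nac b).
  by rewrite finite_setU; split; [exact: finite_set1|exists n].
have [z [[az zmin] _]] :=
  @card_wo kappa [pred c | a < c] (ex_intro _ c ac).
exists z.
have -> : [set b | b < z] = a |` [set b | b < a].
  apply/seteqP; split => b /=.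
    move=> bz; have [ba|ab|->] := ltgtP b a; [by right| |by left].
    by move: bz; rewrite ltNge zmin.
  by move=> [->//|ba]; exact: lt_trans ba az.
have afin : finite_set [set b | b < a] by exists n.
have finU : finite_set (a |` [set b | b < a]) by rewrite finite_setU.
rewrite -(fset_setK finU); apply/card_eq_fsetP.
rewrite fset_setU1// cardfsU1 (card_fset_set an) in_fset_set//.
by rewrite memNset//= ltxx.
Qed.

(* The natural number n, as an element of kappa. *)
Definition finite_ordinal (kappa : infinite_cardinal) (n : nat) : kappa :=
  projT1 (cid (finite_ordinal_exists kappa n)).

Section bounded_topology.
Variable kappa : infinite_cardinal.

Definition baire_space : Type := kappa -> kappa.
HB.instance Definition _ := Choice.copy baire_space (kappa -> kappa).

Definition bounded_sequence : Type :=
  {a : kappa & {b : kappa | b < a} -> kappa}.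

Definition cone (p : bounded_sequence) : set baire_space :=
  [set eta | forall b : {b : kappa | b < projT1 p}, eta (sval b) = projT2 p b].

Definition bounded_open : set_system baire_space :=
  [set U | forall eta, U eta -> exists p, cone p eta /\ cone p `<=` U].

Lemma bounded_openT : bounded_open setT.
Proof.
move=> eta _; have [a _] := infinite_setN0 (@card_infinite kappa).
by exists (existT _ a (fun b => eta (sval b))).
Qed.

Lemma bounded_openI : setI_closed bounded_open.
Proof.
move=> U V oU oV eta [/oU[p [pe pU]] /oV[q [qe qV]]].
have [pq|qp] := leP (projT1 p) (projT1 q).
- exists q; split => // xi qxi; split; last exact: qV.
  apply: pU => -[b bp]; rewrite -pe /=.
  have bq := lt_le_trans bp pq.
  by rewrite (qxi (exist _ b bq)) -(qe (exist _ b bq)).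
- exists p; split => // xi pxi; split; first exact: pU.
  apply: qV => -[b bq]; rewrite -qe /=.
  have bp := lt_trans bq qp.
  by rewrite (pxi (exist _ b bp)) -(pe (exist _ b bp)).
Qed.

Lemma bounded_open_bigU (I : Type) (f : I -> set baire_space) :
  (forall i, bounded_open (f i)) -> bounded_open (\bigcup_i f i).
Proof.
move=> of_ eta [i _ /of_[p [pe pf]]]; exists p; split=> // xi /pf fxi.
by exists i.
Qed.

HB.instance Definition _ := isOpenTopological.Build baire_space
  bounded_openT bounded_openI bounded_open_bigU.

Definition cantor_set : set baire_space :=
  [set eta | forall a, eta a = finite_ordinal kappa 0 \/
                       eta a = finite_ordinal kappa 1].

End bounded_topology.

(* A countable relational vocabulary: [index P = m] means that P is P_m. *)
Record vocabulary := Vocabulary {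
  symbol :> Type;
  index : symbol -> nat;
  index_inj : injective index;
  arity : symbol -> nat }.

Record structure (L : vocabulary) := Structure {
  domain :> Type;
  interp : forall P : L, (arity P).-tuple domain -> Prop }.

Section morphisms.
Variables (L : vocabulary) (A B : structure L).

Definition is_embedding (f : A -> B) : Prop :=
  injective f /\
  forall (P : L) (a : (arity P).-tuple A), interp a <-> interp (map_tuple f a).

Definition embeds : Prop := exists f : A -> B, is_embedding f.

Definition isomorphic : Prop :=
  exists f : A -> B, bijective f /\ is_embedding f.

End morphisms.

(* The vocabulary with P_0, of arity 2, as its only symbol. *)
Definition binary_vocabulary : vocabulary :=
  @Vocabulary unit (fun=> 0%N)
    (fun x y _ => match x, y with tt, tt => erefl end) (fun=> 2%N).

Definition brel (A : structure binary_vocabulary) (x y : A) : Prop :=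
  @interp _ A tt [tuple x; y].

Definition is_DLO (A : structure binary_vocabulary) : Prop :=
  [/\ forall x : A, ~ brel x x,
      forall x y z : A, brel x y -> brel y z -> brel x z &
      forall x y : A, [\/ brel x y, x = y | brel y x]] /\
  [/\ forall x y : A, brel x y -> exists z, brel x z /\ brel z y,
      forall x : A, exists y, brel y x &
      forall x : A, exists y, brel x y].

Definition is_graph (A : structure binary_vocabulary) : Prop :=
  (forall x : A, ~ brel x x) /\ (forall x y : A, brel x y -> brel y x).

Section coding.
Variables (kappa : infinite_cardinal) (pi : seq kappa -> kappa).

Definition coded (L : vocabulary) (eta : baire_space kappa) : structure L :=
  @Structure L kappa (fun P a =>
    eta (pi (finite_ordinal kappa (index P) :: a)) = finite_ordinal kappa 1).

Definition Mod (L : vocabulary) (T : structure L -> Prop) :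
    set (baire_space kappa) :=
  [set eta | cantor_set eta /\ T (coded L eta)].

Definition Mod_DLO : set (baire_space kappa) := Mod is_DLO.
Definition Mod_G : set (baire_space kappa) := Mod is_graph.

End coding.

(* Main.v *)
(** Code a linear order (X, <) by the graph with an apex c, two disjoint cliques
    {x0 | x in X} and {x1 | x in X}, and a vertex (x, y) for each pair, where c
    is joined to every x0, (x, y) is joined to x0 and y1, and c is joined to
    (x, y) iff x <= y.  No vertex (x, y) lies on a 4-clique, so an embedding of
    such graphs sends the two cliques into the two cliques; a triangle
    c, x0, (x, x) then forces c to c, x0 to some (g x)0, x1 to some (h x)1 and
    (x, y) to (g x, h y).  Hence x <= y iff g x <= h y, and x < y yields
    g x <= h x < g y: the map g embeds the orders, bijectively if the embedding
    of graphs is bijective.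

    Only the edges between c and the (x, y) depend on the order.  For
    continuity, also at singular kappa, (x, y) is named by an ordinal such that
    the codes of these edges are not below the code of "x < y": fewer than
    kappa candidates are excluded.  Then F(eta) below a depends only on eta
    below a. *)

Require Import Defs.
From mathcomp Require Import all_boot all_order.
From mathcomp Require Import all_classical topology.

Set Implicit Arguments.
Unset Strict Implicit.
Unset Printing Implicit Defensive.

Import Order.TTheory.

Local Open Scope classical_set_scope.
Local Open Scope card_scope.

(** * Embeddings of binary relations and of strict linear orders *)

Definition rel_embedding (T U : Type) (r : T -> T -> Prop) (s : U -> U -> Prop)
    (f : T -> U) : Prop :=
  injective f /\ forall x y, r x y <-> s (f x) (f y).

Lemma rel_embedding_can (T U : Type) (r : T -> T -> Prop) (s : U -> U -> Prop)
    (f : T -> U) (g : U -> T) :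
  cancel f g -> cancel g f -> rel_embedding r s f -> rel_embedding s r g.
Proof.
move=> fK gK [_ frs]; split; first exact: can_inj gK.
by move=> x y; rewrite frs !gK.
Qed.

Record order_without_max (T : Type) (lt : T -> T -> Prop) : Prop := OrderWithoutMax {
  lt_irr : forall x, ~ lt x x;
  lt_tr : forall x y z, lt x y -> lt y z -> lt x z;
  lt_tot : forall x y, [\/ lt x y, x = y | lt y x];
  lt_upper : forall x, exists y, lt x y }.

(** Totality of the source and irreflexivity of the target turn strict monotonicity into injectivity
    and reflection. *)
Lemma monotone_embedding (T U : Type) (lt : T -> T -> Prop)
    (lt' : U -> U -> Prop) (f : T -> U) :
  order_without_max lt -> order_without_max lt' ->
  (forall x y, lt x y -> lt' (f x) (f y)) -> rel_embedding lt lt' f.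
Proof.
move=> oT oU fmono; split.
  move=> x y fxy; case: (lt_tot oT x y) => // /fmono; rewrite fxy => h;
    by case: (lt_irr oU h).
move=> x y; split; first exact: fmono.
move=> fxy; case: (lt_tot oT x y) => [//|xy|/fmono fyx].
  by rewrite xy in fxy; case: (lt_irr oU fxy).
by case: (lt_irr oU (lt_tr oU fxy fyx)).
Qed.

(** * The gadget graph of an order and its cliques *)

Inductive gadget (T : Type) : Type :=
| Apex
| Src of T
| Tgt of T
| Arc of T & T.
Arguments Apex {T}.

Definition gadget_map (T U : Type) (f : T -> U) (u : gadget T) : gadget U :=
  match u with
  | Apex => Apex
  | Src x => Src (f x)
  | Tgt x => Tgt (f x)
  | Arc x y => Arc (f x) (f y)
  end.

Lemma gadget_map_inj (T U : Type) (f : T -> U) :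
  injective f -> injective (gadget_map f).
Proof.
by move=> fi [|x|x|x x'] [|y|y|y y'] //= [] => [/fi->|/fi->|/fi-> /fi->].
Qed.

Lemma gadget_mapK (T U : Type) (f : T -> U) (g : U -> T) :
  cancel f g -> cancel (gadget_map f) (gadget_map g).
Proof. by move=> fK [|x|x|x y] /=; rewrite ?fK. Qed.

(* The only edges depending on [lt] are those joining [Apex] to an [Arc]. *)
Definition gadget_adj (T : Type) (lt : T -> T -> Prop) (u v : gadget T) : Prop :=
  match u, v with
  | Apex, Src _ | Src _, Apex => True
  | Src x, Src y | Tgt x, Tgt y => x <> y
  | Apex, Arc x y | Arc x y, Apex => x = y \/ lt x y
  | Src x, Arc y _ | Arc y _, Src x => x = y
  | Tgt x, Arc _ y | Arc _ y, Tgt x => x = y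
  | _, _ => False
  end.

Section gadget_adj.
Context {T : Type} {lt : T -> T -> Prop}.
Implicit Types u v w : gadget T.

Let E := gadget_adj lt.

Lemma gadget_adjC u v : E u v -> E v u.
Proof. by case: u v => [|x|x|x x'] [|y|y|y y'] //= /nesym. Qed.

Lemma gadget_adj_irr u : ~ E u u.
Proof. by case: u => [|x|x|x y] //= xx; exact: xx. Qed.

Definition is_arc u := if u is Arc _ _ then true else false.

(** [Apex] belongs to the [Src] clique; the value on an [Arc] is a mere default. *)
Definition on_src_side u := if u is Tgt _ then false else true.

(** The neighbours of [Arc x y] are among [Apex], [Src x] and [Tgt y], and [Tgt y] is adjacent to
    neither of the other two. *)
Lemma clique4_not_arc u v1 v2 v3 :
  E u v1 -> E u v2 -> E u v3 -> E v1 v2 -> E v1 v3 -> E v2 v3 -> ~~ is_arc u.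
Proof.
case: u => // x y.
case: v1 => [|a|a|a a'] //=; case: v2 => [|b|b|b b'] //=;
  case: v3 => [|c|c|c c'] //=; by intuition congruence.
Qed.

Lemma adj_not_arc u v : ~~ is_arc u -> ~~ is_arc v ->
  E u v <-> on_src_side u = on_src_side v /\ u <> v.
Proof.
case: u => [|x|x|x x'] // _; case: v => [|y|y|y y'] //= _;
  by split=> [h|[]]; intuition congruence.
Qed.

End gadget_adj.

Lemma gadget_map_embedding (T U : Type) (lt : T -> T -> Prop)
    (lt' : U -> U -> Prop) (f : T -> U) : rel_embedding lt lt' f ->
  rel_embedding (gadget_adj lt) (gadget_adj lt') (gadget_map f).
Proof.
move=> [fi flt]; split; first exact: gadget_map_inj.
have fe x y : (x = y) <-> (f x = f y) by split=> [->|/fi].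
by move=> [|x|x|x x'] [|y|y|y y'] //=; rewrite -?flt -?fe.
Qed.

(** * Rigidity of embeddings between gadget graphs *)

Section rigidity.
Context {T U : Type} {lt : T -> T -> Prop} {lt' : U -> U -> Prop}.
Hypotheses (oT : order_without_max lt) (oU : order_without_max lt').
Variable phi : gadget T -> gadget U.
Hypothesis phiP : rel_embedding (gadget_adj lt) (gadget_adj lt') phi.

Let phi_inj : injective phi := phiP.1.

Let adj_phi u v : gadget_adj lt u v -> gadget_adj lt' (phi u) (phi v).
Proof. exact: (phiP.2 u v).1. Qed.

Let three_others (x : T) : exists y z t : T,
  [/\ x <> y, x <> z & x <> t] /\ [/\ y <> z, y <> t & z <> t].
Proof.
have [y xy] := lt_upper oT x; have [z yz] := lt_upper oT y.
have [t zt] := lt_upper oT z; exists y, z, t.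
have ne a b : lt a b -> a <> b by move=> + ab; rewrite ab => /(lt_irr oT).
have xz := lt_tr oT xy yz; have yt := lt_tr oT yz zt; have xt := lt_tr oT xz zt.
by split; split; exact: ne.
Qed.

Let src_not_arc x : ~~ is_arc (phi (Src x)).
Proof.
have [y [z [_ [[xy xz _] [yz _ _]]]]] := three_others x.
apply: (@clique4_not_arc _ lt' _ (phi Apex) (phi (Src y)) (phi (Src z)));
  exact: adj_phi.
Qed.

Let tgt_not_arc x : ~~ is_arc (phi (Tgt x)).
Proof.
have [y [z [t [[xy xz xt] [yz yt zt]]]]] := three_others x.
apply: (@clique4_not_arc _ lt' _ (phi (Tgt y)) (phi (Tgt z)) (phi (Tgt t)));
  exact: adj_phi.
Qed.

(** The point [x] excludes an empty [T], for which [Apex] is the only vertex and could be sent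
    anywhere. *)
Let apex_not_arc (x : T) : ~~ is_arc (phi Apex).
Proof.
have [y [z [t [[xy xz xt] [yz yt zt]]]]] := three_others x.
apply: (@clique4_not_arc _ lt' _ (phi (Src y)) (phi (Src z)) (phi (Src t)));
  exact: adj_phi.
Qed.

Let src_apex_side x : on_src_side (phi (Src x)) = on_src_side (phi Apex).
Proof.
have /adj_phi : gadget_adj lt (Src x) Apex by [].
by case/(adj_not_arc (src_not_arc x) (apex_not_arc x)).
Qed.

(** Two distinct non-arcs on one side are adjacent, and [phi] reflects adjacency. *)
Let src_tgt_side x y : on_src_side (phi (Src x)) <> on_src_side (phi (Tgt y)).
Proof.
move=> side; suff : gadget_adj lt (Src x) (Tgt y) by [].
apply/phiP.2/(adj_not_arc (src_not_arc x) (tgt_not_arc y)).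
by split=> // /phi_inj.
Qed.

(** A non-arc image would be adjacent to vertices on both sides. *)
Let arc_is_arc x y : is_arc (phi (Arc x y)).
Proof.
apply/negPn/negP => Na; apply: (@src_tgt_side x y).
have /adj_phi : gadget_adj lt (Src x) (Arc x y) by [].
have /adj_phi : gadget_adj lt (Tgt y) (Arc x y) by [].
move=> /(adj_not_arc (tgt_not_arc y) Na)[-> _].
by move=> /(adj_not_arc (src_not_arc x) Na)[].
Qed.

(* The triangle on [Apex], [Src x] and [Arc x x] locates the image of [Apex]. *)
Let sort_dichotomy x : exists a b, phi (Tgt x) = Tgt b /\
  ((phi Apex = Apex /\ phi (Src x) = Src a) \/
   (phi Apex = Src a /\ phi (Src x) = Apex)).
Proof.
have /adj_phi : gadget_adj lt (Src x) (Arc x x) by [].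
have /adj_phi : gadget_adj lt (Tgt x) (Arc x x) by [].
have /adj_phi : gadget_adj lt Apex (Arc x x) by left.
have /adj_phi : gadget_adj lt Apex (Src x) by [].
move: (arc_is_arc x x) (@src_tgt_side x x) (@src_apex_side x).
move: (src_not_arc x) (tgt_not_arc x) (apex_not_arc x).
case: (phi (Arc x x)) => // a b.
by case: (phi (Src x)) => [|s|s|//]; case: (phi (Tgt x)) => [|t|t|//];
  case: (phi Apex) => [|c|c|//] //= *; subst;
  first [by exfalso; intuition congruence
        |by do 2 eexists; split=> //; left |by do 2 eexists; split=> //; right].
Qed.

(** The other alternative would send two distinct [Src] vertices to [Apex]. *)
Let phi_apex (x : T) : phi Apex = Apex.
Proof.
have [y [_ [_ [[xy _ _] _]]]] := three_others x.
have [a [_ [_ [[//]|[_ px]]]]] := sort_dichotomy x.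
have [b [_ [_ [[//]|[_ py]]]]] := sort_dichotomy y.
by have /phi_inj[] : phi (Src x) = phi (Src y) by rewrite px py.
Qed.

Let phi_src_tgt x : exists a b, phi (Src x) = Src a /\ phi (Tgt x) = Tgt b.
Proof.
have [a [b [pt [[_ ps]|[pa _]]]]] := sort_dichotomy x; first by exists a, b.
by move: pa; rewrite phi_apex.
Qed.

(** The equation for [Src] is kept so that inverse graph maps yield inverse order maps. *)
Lemma gadget_embedding_src : exists g : T -> U,
  (forall x, phi (Src x) = Src (g x)) /\ rel_embedding lt lt' g.
Proof.
have /choice[g] := phi_src_tgt; move=> /choice[h gh].
have gP x : phi (Src x) = Src (g x) by have [] := gh x.
have hP x : phi (Tgt x) = Tgt (h x) by have [] := gh x.
exists g; split=> //; apply: monotone_embedding => //.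
have arcP x y : phi (Arc x y) = Arc (g x) (h y).
  have /adj_phi : gadget_adj lt (Src x) (Arc x y) by [].
  have /adj_phi : gadget_adj lt (Tgt y) (Arc x y) by [].
  rewrite gP hP; move: (arc_is_arc x y).
  by case: (phi (Arc x y)) => //= a b _ -> ->.
(* The maps [g] and [h] may differ, so the edge at [Apex] only compares a [g] value with an [h]
   value. *)
have le x y : (x = y \/ lt x y) <-> (g x = h y \/ lt' (g x) (h y)).
  by have := phiP.2 Apex (Arc x y); rewrite (phi_apex x) arcP.
move=> x y xy.
have gxhx : g x = h x \/ lt' (g x) (h x) by apply/le; left.
have hxgy : lt' (h x) (g y).
  have Nyx : ~ (g y = h x \/ lt' (g y) (h x)).
    move/le => [yx|yx]; first by rewrite yx in xy; exact: (lt_irr oT xy).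
    exact: (lt_irr oT (lt_tr oT xy yx)).
  by case: (lt_tot oU (h x) (g y)) => // [e|l]; case: Nyx; [left|right].
by case: gxhx => [->//|l]; exact: (lt_tr oU l hxgy).
Qed.

End rigidity.

(** * Gadget graphs on a prescribed vertex set *)

Section labelled_graph.
Variables (K : Type) (lab : gadget K -> K).
Hypothesis lab_inj : injective lab.

(* The elements of [K] that are not labels are isolated vertices. *)
Definition labelled_adj (lt : K -> K -> Prop) (k l : K) : Prop :=
  exists u v, [/\ k = lab u, l = lab v & gadget_adj lt u v].

Lemma labelled_adjE lt u v : labelled_adj lt (lab u) (lab v) <-> gadget_adj lt u v.
Proof.
by split=> [[u' [v' [/lab_inj-> /lab_inj->]]]//|uv]; exists u, v.
Qed.

Definition label_map (f : K -> K) (k : K) : K :=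
  if pselect (exists u, lab u = k) is left e then lab (gadget_map f (projT1 (cid e)))
  else k.

Lemma label_map_lab f u : label_map f (lab u) = lab (gadget_map f u).
Proof.
rewrite /label_map; case: pselect => [e|[]]; last by exists u.
by case: (cid e) => v /= /lab_inj->.
Qed.

Lemma label_map_id f k : ~ (exists u, lab u = k) -> label_map f k = k.
Proof. by rewrite /label_map; case: pselect. Qed.

Lemma label_mapK f g : cancel f g -> cancel (label_map f) (label_map g).
Proof.
move=> fK k; have [[u <-]|Nk] := pselect (exists u, lab u = k).
  by rewrite !label_map_lab gadget_mapK.
by rewrite !label_map_id// label_map_id.
Qed.

Lemma label_map_embedding lt lt' f : rel_embedding lt lt' f ->
  rel_embedding (labelled_adj lt) (labelled_adj lt') (label_map f).
Proof.
move=> /[dup] -[fi _] /gadget_map_embedding[_ gf].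
have labP k : (exists u, lab u = k) <-> (exists u, lab u = label_map f k).
  split=> [[u <-]|]; first by exists (gadget_map f u); rewrite label_map_lab.
  by have [//|Nk] := pselect (exists u, lab u = k); rewrite label_map_id.
split.
  move=> k l e; have [[u uk]|Nk] := pselect (exists u, lab u = k).
    have [v vl] : exists v, lab v = l.
      by apply/labP; rewrite -e; apply/(labP k); exists u.
    move: e; rewrite -uk -vl !label_map_lab.
    by move=> /lab_inj/(gadget_map_inj fi)->.
  have Nl : ~ (exists u, lab u = l) by move/labP; rewrite -e => /(labP k).
  by move: e; rewrite !label_map_id.
move=> k l; split=> [[u [v [-> -> uv]]]|[u [v [ku lv uv]]]].
  by rewrite !label_map_lab labelled_adjE -gf.
have [u' u'k] : exists u', lab u' = k by apply/labP; exists u.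
have [v' v'l] : exists v', lab v' = l by apply/labP; exists v.
rewrite -u'k -v'l labelled_adjE gf.
move: ku lv; rewrite -u'k -v'l !label_map_lab => /lab_inj-> /lab_inj->.
exact: uv.
Qed.

Variables lt lt' : K -> K -> Prop.
Hypotheses (oK : order_without_max lt) (oK' : order_without_max lt').

Lemma gadget_adj_neighbour u : exists v, gadget_adj lt u v.
Proof.
case: u => [|x|x|x y]; [|by exists Apex| |by exists (Src x)].
  (* [lab Apex] serves as some element of [K]. *)
  by exists (Src (lab Apex)).
by have [y xy] := lt_upper oK x; exists (Arc y x).
Qed.

(** Labels have neighbours and non-labels have none, so [f] sends labels to labels and induces a map
    of gadgets. *)
Lemma labelled_embedding_src f :
  rel_embedding (labelled_adj lt) (labelled_adj lt') f ->
  exists g, (forall x, f (lab (Src x)) = lab (Src (g x))) /\ rel_embedding lt lt' g.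
Proof.
move=> [fi fE].
have /choice[phi phiE] u : exists v, f (lab u) = lab v.
  have [v /labelled_adjE/fE[u' [_ [-> _ _]]]] := gadget_adj_neighbour u.
  by exists u'.
have phiP : rel_embedding (gadget_adj lt) (gadget_adj lt') phi.
  split=> [u v uv|u v]; first by apply/lab_inj/fi; rewrite !phiE uv.
  by rewrite -labelled_adjE fE !phiE labelled_adjE.
have [g [gP gE]] := gadget_embedding_src oK oK' phiP.
by exists g; split=> // x; rewrite phiE gP.
Qed.

End labelled_graph.

Lemma labelled_embeds (K : Type) (lab : gadget K -> K) (lt lt' : K -> K -> Prop) :
  injective lab -> order_without_max lt -> order_without_max lt' ->
  (exists f, rel_embedding lt lt' f) <->
  (exists f, rel_embedding (labelled_adj lab lt) (labelled_adj lab lt') f).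
Proof.
move=> labi oK oK'; split=> [[f /(label_map_embedding labi)]|[f]].
  by exists (label_map lab f).
by move=> /(labelled_embedding_src labi oK oK')[g [_ gP]]; exists g.
Qed.

Lemma labelled_isomorphic (K : Type) (lab : gadget K -> K)
    (lt lt' : K -> K -> Prop) :
  injective lab -> order_without_max lt -> order_without_max lt' ->
  (exists f, bijective f /\ rel_embedding lt lt' f) <->
  (exists f, bijective f /\
     rel_embedding (labelled_adj lab lt) (labelled_adj lab lt') f).
Proof.
move=> labi oK oK'; split=> [[f [[g fK gK] fE]]|[f [[g fK gK] fE]]].
  exists (label_map lab f); split; last exact: label_map_embedding.
  by exists (label_map lab g); apply: label_mapK.
have gE := rel_embedding_can fK gK fE.
have [f' [f'P f'E]] := labelled_embedding_src labi oK oK' fE.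
(* The inverse embedding yields its own map [g']; comparing [Src] labels shows it inverse to
   [f']. *)
have [g' [g'P _]] := labelled_embedding_src labi oK' oK gE.
exists f'; split=> //; exists g' => x.
  by have /labi[] : lab (Src (g' (f' x))) = lab (Src x) by rewrite -g'P -f'P fK.
by have /labi[] : lab (Src (f' (g' x))) = lab (Src x) by rewrite -f'P -g'P gK.
Qed.

(** * Passage from structures to relations *)

Lemma DLO_order_without_max (A : structure binary_vocabulary) :
  is_DLO A -> order_without_max (@brel A).
Proof. by move=> [[irr tr tot] [_ _ upp]]; constructor. Qed.

Lemma is_embedding_brel (A B : structure binary_vocabulary) (f : A -> B) :
  is_embedding f <-> rel_embedding (@brel A) (@brel B) f.
Proof.
have map2 x y : map_tuple f [tuple x; y] = [tuple f x; f y] by exact: val_inj.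
split=> -[fi fE]; split=> //; first by move=> x y; rewrite /brel -map2; exact: fE.
case=> a; have [x [y ->]] : exists x y : A, a = [tuple x; y] :> 2.-tuple A.
  by case: a => [[|x [|y []]] // s]; exists x, y; exact: val_inj.
by rewrite [map_tuple _ _]map2; exact: fE.
Qed.

(** * Labels in [kappa], the coded graph and continuity *)

Section labelling.
Variables (kappa : infinite_cardinal) (pi : seq kappa -> kappa).
Hypothesis pi_inj : injective pi.

Let o0 : kappa := finite_ordinal kappa 0.
Let o1 : kappa := finite_ordinal kappa 1.

Lemma finite_ordinal01 : o0 <> o1.
Proof.
rewrite /o0 /o1 /finite_ordinal; case: cid => a /= a0; case: cid => b /= b1 ab.
move: b1; rewrite -ab => /card_esym/card_eq_trans/(_ a0).
by rewrite II0 II1 card_eq0 => /eqP/seteqP[/(_ 0%N)] /(_ erefl).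
Qed.

(** Otherwise [f] would inject [kappa] into a proper initial segment. *)
Lemma injection_unbounded (f : kappa -> kappa) (a : kappa) :
  injective f -> exists b, (a <= f b)%O.
Proof.
move=> fi; apply: contrapT => /forallNP Nf; apply: (@card_initial kappa a).
rewrite -(card_le_eql (inj_card_eq (f := f) (A := setT) _)); last first.
  by move=> x y _ _ /fi.
by apply: subset_card_le => _ [b _ <-] /=; rewrite ltNge; apply/negP/Nf.
Qed.

(* This replaces the fact that two sets of size smaller than [kappa] have a
   union of size smaller than [kappa]. *)
Lemma injections_unbounded (f g : kappa -> kappa -> kappa) (a : kappa) :
  (forall x y x' y', f x y = f x' y' -> x = x') ->
  (forall x, injective (g x)) ->
  exists x y, (a <= f x y)%O /\ (a <= g x y)%O.
Proof.
(* First each [x] gets a [y = h x] that makes [g] large; then [f x (h x)] is still injective in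
   [x]. *)
move=> fi gi; have /choice[h ha] x := injection_unbounded a (gi x).
have [x fa] := @injection_unbounded (fun x => f x (h x)) a
  (fun x x' => @fi _ _ _ _).
by exists x, (h x).
Qed.

(** Both orientations of the edge to [Apex] must have large codes, hence two free entries. *)
Lemma arc_label_exists (xy : kappa * kappa) : exists ts : kappa * kappa,
  let l := pi [:: xy.1; xy.2; ts.1; ts.2] in
  (pi [:: o0; xy.1; xy.2] <= pi [:: o0; l; pi [::]])%O /\
  (pi [:: o0; xy.1; xy.2] <= pi [:: o0; pi [::]; l])%O.
Proof.
case: xy => x y; pose l t s := pi [:: x; y; t; s].
have [|t z z'|t [s [ts st]]] := @injections_unbounded
  (fun t s => pi [:: o0; l t s; pi [::]])
  (fun t s => pi [:: o0; pi [::]; l t s]) (pi [:: o0; x; y]).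
- by move=> t s t' s' /pi_inj[] /pi_inj[].
- by move=> /pi_inj[] /pi_inj[].
- by exists (t, s).
Qed.

Definition arc_params (x y : kappa) : kappa * kappa :=
  projT1 (cid (arc_label_exists (x, y))).

(** List lengths 0, 1, 2 and 4 keep the four kinds of vertices apart. *)
Definition label (u : gadget kappa) : kappa :=
  match u with
  | Apex => pi [::]
  | Src x => pi [:: x]
  | Tgt x => pi [:: x; x]
  | Arc x y => pi [:: x; y; (arc_params x y).1; (arc_params x y).2]
  end.

Lemma label_inj : injective label.
Proof.
by move=> [|x|x|x x'] [|y|y|y y'] //= /pi_inj; congruence.
Qed.

Lemma label_arc x y :
  (pi [:: o0; x; y] <= pi [:: o0; label (Arc x y); label Apex])%O /\
  (pi [:: o0; x; y] <= pi [:: o0; label Apex; label (Arc x y)])%O.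
Proof. by rewrite /= /arc_params; case: cid. Qed.

Let A (eta : baire_space kappa) := coded pi binary_vocabulary eta.

Definition graph_code (eta : baire_space kappa) : baire_space kappa := fun z =>
  if `[< exists k l, z = pi [:: o0; k; l] /\
                     labelled_adj label (@brel (A eta)) k l >]
  then o1 else o0.

Lemma brel_graph_code eta :
  @brel (A (graph_code eta)) = labelled_adj label (@brel (A eta)).
Proof.
apply/funext => k; apply/funext => l; apply/propext.
rewrite {1}/brel /= /graph_code -/o0 -/o1.
case: asboolP => [[k' [l' [/pi_inj[<- <-]]]]//|Nkl].
by split=> [/finite_ordinal01//|kl]; case: Nkl; exists k, l.
Qed.

Lemma graph_code_Mod_G eta : Mod_G pi (graph_code eta).
Proof.
split; first by move=> z; rewrite /graph_code; case: ifP; [right|left].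
rewrite /is_graph -/(A _) brel_graph_code; split.
  by move=> k [u [v [-> /label_inj<- /gadget_adj_irr]]].
by move=> k l [u [v [-> -> /gadget_adjC]]]; exists v, u.
Qed.

Definition DLO_graph (eta : set_type (Mod_DLO pi)) : set_type (Mod_G pi) :=
  SigSub (mem_set (graph_code_Mod_G (set_val eta))).

(** The order enters the edge coded by [z] through at most one value of [eta], at a code not above
    [z]. *)
Lemma graph_code_local (eta xi : baire_space kappa) (a z : kappa) :
  (forall b, (b < a)%O -> eta b = xi b) -> (z < a)%O ->
  graph_code eta z = graph_code xi z.
Proof.
move=> agree za; rewrite /graph_code; congr (if _ then _ else _).
apply: asbool_equiv_eq.
have agree_le b : (b <= z)%O -> eta b = xi b.
  by move=> bz; rewrite agree// (le_lt_trans bz za).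
suff adjE u v : z = pi [:: o0; label u; label v] ->
    gadget_adj (@brel (A eta)) u v <-> gadget_adj (@brel (A xi)) u v.
  by split=> -[k [l [zE [u [v [ku lv uv]]]]]]; exists k, l; split=> //;
    rewrite ku lv in zE; exists u, v; split=> //; apply/(adjE _ _ zE).
case: u v => [|x|x|x x'] [|y|y|y y'] //= zE; rewrite agree_le// zE.
- by have [] := label_arc y y'.
- by have [] := label_arc x x'.
Qed.

Lemma cone_open (p : bounded_sequence kappa) : open (cone p).
Proof. by move=> eta ep; exists p; split=> // xi. Qed.

Lemma DLO_graph_continuous : continuous DLO_graph.
Proof.
apply: (@continuous_comp_initial _ _ _ set_val) => eta U.
rewrite nbhsE => -[V [oV Veta] VU].
have [p [ep pV]] := oV _ Veta.
(* By locality, the initial segment of [eta] of the same length as [p] suffices. *)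
pose q : bounded_sequence kappa :=
  existT _ (projT1 p) (fun b => set_val eta (sval b)).
have : nbhs eta (set_val @^-1` cone q).
  apply: initial_continuous; apply: open_nbhs_nbhs; split; first exact: cone_open.
  by [].
apply: filterS => xi /= xiq; apply/VU/pV => b; rewrite -ep.
apply: (@graph_code_local _ _ (projT1 p)); last exact: (proj2_sig b).
by move=> c cp; exact: (xiq (exist _ c cp)).
Qed.

End labelling.

Theorem theorem4p6 (kappa : infinite_cardinal) (pi : seq kappa -> kappa)
    (pi_bij : bijective pi) :
  exists F : set_type (Mod_DLO pi) -> set_type (Mod_G pi),
    continuous F /\
    forall eta xi : set_type (Mod_DLO pi),
      let A (zeta : baire_space kappa) := coded pi binary_vocabulary zeta in
      (embeds (A (set_val eta)) (A (set_val xi)) <->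
       embeds (A (set_val (F eta))) (A (set_val (F xi)))) /\
      (isomorphic (A (set_val eta)) (A (set_val xi)) <->
       isomorphic (A (set_val (F eta))) (A (set_val (F xi)))).
Proof.
have pi_inj := bij_inj pi_bij.
exists (DLO_graph pi_inj); split; first exact: DLO_graph_continuous.
move=> eta xi A.
have ord (zeta : set_type (Mod_DLO pi)) :
    order_without_max (@brel (A (set_val zeta))).
  by apply: DLO_order_without_max; have /set_mem[] := valP zeta.
have lab := @label_inj _ _ pi_inj.
split.
- have := labelled_embeds lab (ord eta) (ord xi).
  rewrite -!brel_graph_code => embE.
  split=> [[f /is_embedding_brel fE]|[f /is_embedding_brel fE]].
    have [g gE] := embE.1 (ex_intro _ f fE).
    by exists g; apply/is_embedding_brel.
  have [g gE] := embE.2 (ex_intro _ f fE).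
  by exists g; apply/is_embedding_brel.
- have := labelled_isomorphic lab (ord eta) (ord xi).
  rewrite -!brel_graph_code => isoE.
  split=> [[f [fb /is_embedding_brel fE]]|[f [fb /is_embedding_brel fE]]].
    have [g [gb gE]] := isoE.1 (ex_intro _ f (conj fb fE)).
    by exists g; split=> //; apply/is_embedding_brel.
  have [g [gb gE]] := isoE.2 (ex_intro _ f (conj fb fE)).
  by exists g; split=> //; apply/is_embedding_brel.
Qed.
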